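(* Let $p\in(0,1)$ and $\sigma>0$, let $X_1$ be Bern($p$) distributed and let $X_2$ be $N(0,\sigma^2)$ distributed, with $X_1$ and $X_2$ independent, and put $X:=X_1+X_2$. Then $X$ is reasonable with respect to $\cos(x)$ if and only if $$\sigma^2 d\big(p^2+(1-p)^2+2(1-p)p\cos(d)\big)+(1-p)p\sin(d)\ge 0\quad\text{for all } d\ge 0.$$ This implies that for $p=1/2$, $(X,\cos(x))$ is not reasonable for any $\sigma>0$, and that for any $p\ne 1/2$ there exists $\sigma_p\in(0,\infty)$ such that for all $\sigma\ge\sigma_p$, $(X,\cos(x))$ is reasonable, and for any $0<\sigma<\sigma_p$, $(X,\cos(x))$ is not reasonable. In addition, for $p\neq 1/2$, $\sigma_p^2\le \dfrac{(1-p)p}{\pi|1-2p|^2}$. Finally, for all $\sigma>0$ and $p\in(0,1)$, $X$ is not reasonable.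
   Context: A dart is a random variable $X$ taking values in $\mathbb{R}$. A payoff function is a measurable function $f:\mathbb{R}\to\mathbb{R}$ bounded from above. For $d>0$, $g_{X,f}(d):=\sup_{a\in\mathbb{R}}Ef(a+dX)$. The pair $(X,f)$ is reasonable (equivalently, $X$ is reasonable with respect to $f$) if $g_{X,f}(d)$ is decreasing (i.e. non-increasing) in $d\in(0,\infty)$. The dart $X$ is reasonable if $(X,f)$ is reasonable for all payoff functions $f$. Bern($p$) is the distribution $p\delta_1+(1-p)\delta_0$. $N(0,\sigma^2)$ is the normal distribution with mean $0$ and variance $\sigma^2$. *)

(* Defs.v *)
From HB Require Import structures.
From mathcomp Require Import all_boot all_order all_algebra.
From mathcomp Require Import all_classical all_reals all_analysis.

Set Implicit Arguments.
Unset Strict Implicit.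
Unset Printing Implicit Defensive.

Import Order.TTheory GRing.Theory Num.Theory.
Import numFieldNormedType.Exports.

Local Open Scope classical_set_scope.
Local Open Scope ring_scope.

Section darts.
Context {R : realType}.

Definition payoff (f : R -> R) : Prop :=
  measurable_fun [set: R] f /\ has_ubound (range f).

Lemma payoff_cos : payoff cos.
Proof.
split; first by apply: measurable_realfun.continuous_measurable_fun; exact: continuous_cos.
by exists 1 => _ [x _ <-]; exact: cos_le1.
Qed.

Context {disp : measure_display} {T : measurableType disp}
  {P : probability T R}.
Implicit Types X Y : {RV P >-> R}.

(* Extended-real valued: a payoff function is only bounded from above, so the
   expectations, hence also their supremum, may be -oo. *)
Definition dart_gain X (f : R -> R) (d : R) : \bar R :=
  ereal_sup [set 'E_P[fun w => (f (a + d * X w))%R]%E | a in [set: R]].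

Definition reasonable_wrt X (f : R -> R) : Prop :=
  forall d1 d2 : R, 0 < d1 -> d1 <= d2 ->
    (dart_gain X f d2 <= dart_gain X f d1)%E.

Definition reasonable X : Prop := forall f, payoff f -> reasonable_wrt X f.

(* Laws are compared on measurable sets only, since measures are total
   functions on [set R] with no meaning outside the sigma-algebra. *)
Definition has_law X (mu : set R -> \bar R) : Prop :=
  forall A : set R, measurable A -> distribution P X A = mu A.

Definition independent_RV X Y : Prop :=
  forall A B : set R, measurable A -> measurable B ->
    P (X @^-1` A `&` Y @^-1` B) = (P (X @^-1` A) * P (Y @^-1` B))%E.

End darts.

Definition bern {R : realType} (p : R) (A : set R) : \bar R :=
  (p%:E * \d_(1%R : R) A + (1 - p)%:E * \d_(0%R : R) A)%E.

(* The second parameter of [normal_prob] is the standard deviation. *)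
Definition bern_plus_normal {R : realType} (p sigma : R)
    {disp : measure_display} {T : measurableType disp} {P : probability T R}
    (X : {RV P >-> R}) : Prop :=
  exists X1 X2 : {RV P >-> R},
    [/\ has_law X1 (bern p),
        has_law X2 (normal_prob 0 sigma),
        independent_RV X1 X2 &
        forall w, X w = X1 w + X2 w].

(* Main.v *)
Require Import Defs.
From HB Require Import structures.
From mathcomp Require Import all_boot all_order all_algebra.
From mathcomp Require Import all_classical all_reals all_analysis.
From mathcomp Require Import measurable_realfun.
From mathcomp Require Import ring lra.

(** The dart [X] is a Bernoulli variable plus an independent centred Gaussian,
    so every exponential moment of [X] is explicit:
      [E (e^(bX) cos (tX + c))]
        = [e^(s^2 (b^2 - t^2) / 2)
           * ((1 - p) cos (t b s^2 + c) + p e^b cos (t b s^2 + t + c))]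
    ([integral_expR_cos_bern_plus_normal]).  It comes from the Gaussian integral
    [Rintegral_expR_cos_normal_pdf]: multiplying a normal density by an
    exponential only moves its mean and rescales it ([normal_pdf_tilt]), which
    reduces the exponential moments to the characteristic function; and the
    latter solves the differential equation [F' = - s^2 t F], because
    differentiation under the integral brings down a factor [x - m] that an
    integration by parts trades for [s^2 t] ([stein_sin]).

    With [b = 0], the expected payoff of the cosine is
    [e^(- s^2 d^2 / 2) ((1 - p) cos a + p cos (a + d))].  The bracket is a sum
    of two oscillations with phase difference [d]; maximizing over [a] gives its
    amplitude [sqrt Q(d)], where [Q = spread p].  The pair is thus reasonable
    iff [e^(- s^2 d^2) Q(d)] is nonincreasing, and the sign of its derivative is
    the stated criterion ([reasonable_cosP]).  If [p = 1/2] then [Q] vanishes at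
    [pi] and not at [2 pi].  If [p <> 1/2] then [Q >= (1 - 2p)^2 > 0], and
    dividing the criterion by [d Q(d)] turns it into a lower bound on [s^2] for
    each [d > 0]; the threshold [sigma_p^2] is the supremum of these bounds.

    That [X] is never reasonable rests on the complex zeros of the moment
    generating function of a Bernoulli variable: [1 - p + p e^z] vanishes at
    [z = (b + i) pi] when [p e^(b pi) = 1 - p].  Hence [e^(by) cos (y + c)] has
    expectation zero at scale [pi], wherever the dart is aimed, while at scale
    [2 pi] a suitable phase [c] makes it positive.  This function need not be
    bounded above, but subtracting a small multiple of [e^(2by)] repairs that:
    the gain at scale [pi] is at most zero and that at scale [2 pi] stays
    positive. *)

Set Implicit Arguments.
Unset Strict Implicit.
Unset Printing Implicit Defensive.

Import Order.TTheory GRing.Theory Num.Theory.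
Import numFieldNormedType.Exports.

Local Open Scope classical_set_scope.
Local Open Scope ring_scope.

(** * Exponentials and trigonometric functions of an affine argument *)

Section affine.
Context {R : realType}.
Implicit Types b c m t x : R.

Lemma normr_cos_le1 x : `|cos x| <= 1.
Proof. by rewrite ler_norml cos_geN1 cos_le1. Qed.

Lemma normr_sin_le1 x : `|sin x| <= 1.
Proof. by rewrite ler_norml sin_geN1 sin_le1. Qed.

Lemma continuous_affine t m c : continuous (fun x : R => t * (x - m) + c).
Proof.
move=> x; apply: (@cvgD _ R^o); last exact: cvg_cst.
apply: cvgM; first exact: cvg_cst.
by apply: (@cvgB _ R^o); [exact: cvg_id|exact: cvg_cst].
Qed.

Lemma continuous_cos_affine t m c :
  continuous (fun x : R => cos (t * (x - m) + c)).
Proof.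
move=> x; apply: (cvg_comp _ cos); last exact: continuous_cos.
exact: continuous_affine.
Qed.

Lemma continuous_sin_affine t m c :
  continuous (fun x : R => sin (t * (x - m) + c)).
Proof.
move=> x; apply: (cvg_comp _ sin); last exact: continuous_sin.
exact: continuous_affine.
Qed.

Lemma continuous_expR_cos b t c :
  continuous (fun x : R => expR (b * x) * cos (t * x + c)).
Proof.
move=> x; apply: cvgM.
  apply: (cvg_comp _ expR); last exact: continuous_expR.
  by apply: cvgM; [exact: cvg_cst|exact: cvg_id].
apply: (cvg_comp _ cos); last exact: continuous_cos.
apply: (@cvgD _ R^o); last exact: cvg_cst.
by apply: cvgM; [exact: cvg_cst|exact: cvg_id].
Qed.

End affine.

(** * Normal densities *)

Section normal_density.
Context {R : realType}.
Notation mu := (@lebesgue_measure R).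
Implicit Types b c m s t x : R.

(** Completing the square: an exponential weight turns a normal density into a
    multiple of another one with the same variance.  This gives all exponential
    moments, integrability and decay at once. *)
Lemma normal_pdf_tilt m s b x : s != 0 ->
  expR (b * x) * normal_pdf m s x =
  expR (b * m + s ^+ 2 * b ^+ 2 / 2) * normal_pdf (m + b * s ^+ 2) s x.
Proof.
move=> s0; rewrite !normal_pdfE// /normal_fun mulrCA [RHS]mulrCA; congr (_ * _).
rewrite -!expRD; congr expR; field; exact: s0.
Qed.

Lemma integrable_expR_normal_pdf m s b : s != 0 ->
  mu.-integrable setT (fun x => (expR (b * x) * normal_pdf m s x)%:E).
Proof.
move=> s0; under eq_fun do rewrite normal_pdf_tilt// EFinM.
exact/integrableZl/integrable_normal_pdf.
Qed.

Lemma integrable_expR_cos_normal_pdf m s b t c : s != 0 ->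
  mu.-integrable setT
    (fun x => (expR (b * x) * cos (t * x + c) * normal_pdf m s x)%:E).
Proof.
move=> s0; apply: (le_integrable measurableT _ _
  (integrable_expR_normal_pdf m b s0)) => /=.
  apply/measurable_EFinP/measurable_funM; last exact: measurable_normal_pdf.
  by apply: continuous_measurable_fun; exact: continuous_expR_cos.
move=> x _; rewrite lee_fin !normrM ler_wpM2r// ler_piMr//.
exact: normr_cos_le1.
Qed.

Lemma normr_le_expRD x : `|x| <= expR x + expR (- x).
Proof.
have := expR_ge1Dx x; have := expR_ge1Dx (- x).
have := expR_gt0 x; have := expR_gt0 (- x).
by case: (ler0P x) => _; lra.
Qed.

(** The weight [|x - m|] is below [e^(x - m) + e^(m - x)], and exponential
    weights keep the density integrable. *)
Lemma integrable_center_normal_pdf m s : s != 0 ->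
  mu.-integrable setT (fun x => (`|x - m| * normal_pdf m s x)%:E).
Proof.
move=> s0; pose g x := ((expR (- m))%:E * (expR (1 * x) * normal_pdf m s x)%:E +
   (expR m)%:E * (expR (-1 * x) * normal_pdf m s x)%:E)%E.
have ig : mu.-integrable setT g.
  by apply: integrableD => //; apply: integrableZl => //;
    exact: integrable_expR_normal_pdf.
apply: (le_integrable measurableT _ _ ig).
  apply/measurable_EFinP/measurable_funM; last exact: measurable_normal_pdf.
  by apply: measurableT_comp => //; exact: measurable_funB.
move=> x _ /=; rewrite /g lee_fin.
rewrite !mulrA -!mulrDl [leLHS]normrM [leRHS]normrM normr_id ler_wpM2r//.
rewrite -!expRD (le_trans (normr_le_expRD _))//.
rewrite ger0_norm ?addr_ge0 ?expR_ge0//.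
by rewrite mul1r mulN1r opprB (addrC x).
Qed.

Lemma derive_normal_pdf m s x : s != 0 ->
  is_derive x 1 (normal_pdf m s) (- (x - m) / s ^+ 2 * normal_pdf m s x).
Proof.
move=> s0; rewrite normal_pdfE// /normal_fun.
apply: is_derive_eq; rewrite /GRing.scale /=; field; exact: s0.
Qed.

(** A tilted density is bounded, so the density itself decays like any
    exponential. *)
Lemma normal_pdf_decay m s b x : s != 0 ->
  normal_pdf m s x <=
  expR (b * m + s ^+ 2 * b ^+ 2 / 2) * normal_peak s * expR (- (b * x)).
Proof.
move=> s0; rewrite expRN ler_pdivlMr ?expR_gt0// mulrC normal_pdf_tilt//.
by rewrite ler_wpM2l ?expR_ge0// normal_pdf_ub.
Qed.

Lemma cvg_normal_pdfy m s : s != 0 ->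
  normal_pdf m s x @[x --> +oo] --> (0 : R).
Proof.
move=> s0; pose C := expR (1 * m + s ^+ 2 * 1 ^+ 2 / 2) * normal_peak s.
apply: (@squeeze_cvgr _ _ _ _ (cst 0) (fun x => C * expR (- x))).
- apply: nearW => x; rewrite /= normal_pdf_ge0/=.
  by rewrite (le_trans (normal_pdf_decay m 1 x s0))// (mul1r x).
- exact: cvg_cst.
- rewrite -(mulr0 C); apply: cvgM; first exact: cvg_cst.
  exact: cvgr_expR.
Qed.

Lemma cvg_normal_pdfNy m s : s != 0 ->
  normal_pdf m s x @[x --> -oo] --> (0 : R).
Proof.
move=> s0; apply/cvgNy_compNP.
rewrite (_ : _ \o _ = normal_pdf (- m) s); first exact: cvg_normal_pdfy.
apply/funext => x /=; rewrite !normal_pdfE// /normal_fun; congr (_ * expR _).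
by field.
Qed.

Lemma integrable_center_bounded_normal_pdf m s (h : R -> R) : s != 0 ->
  continuous h -> (forall x, `|h x| <= 1) ->
  mu.-integrable setT (fun x => ((x - m) * h x * normal_pdf m s x)%:E).
Proof.
move=> s0 ch h1.
apply: (le_integrable measurableT _ _
  (integrable_center_normal_pdf m s0)) => /=.
  apply/measurable_EFinP/measurable_funM; last exact: measurable_normal_pdf.
  apply: measurable_funM; first exact: measurable_funB.
  exact: continuous_measurable_fun.
by move=> x _; rewrite lee_fin !normrM ler_wpM2r// normr_id ler_piMr.
Qed.

Lemma integrable_bounded_normal_pdf m s (h : R -> R) : s != 0 ->
  continuous h -> (forall x, `|h x| <= 1) ->
  mu.-integrable setT (fun x => (h x * normal_pdf m s x)%:E).
Proof.
move=> s0 ch h1.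
apply: (le_integrable measurableT _ _ (integrable_normal_pdf m s)) => /=.
  apply/measurable_EFinP/measurable_funM; last exact: measurable_normal_pdf.
  exact: continuous_measurable_fun.
by move=> x _; rewrite lee_fin !normrM ler_piMl.
Qed.

End normal_density.

(** * Integrating a derivative over the line *)

Section integral_derivative.
Context {R : realType}.
Notation mu := (@lebesgue_measure R).

(** Integrate over the interval [[-n, n]] by the fundamental theorem of calculus
    and let [n] grow, with dominating function [|f|]. *)
Lemma integral_derive_eq0 (F f : R -> R) :
  (forall x : R, is_derive x (1 : R) F (f x)) -> continuous f ->
  mu.-integrable setT (EFin \o f) ->
  F x @[x --> +oo] --> (0 : R) -> F x @[x --> -oo] --> (0 : R) ->
  \int[mu]_x f x = 0.
Proof.
move=> dF cf intf Fy FNy.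
pose I n : set R := `[(- n.+1%:R)%R, n.+1%:R]%classic.
have n_cvg : (n.+1%:R : R) @[n --> \oo] --> +oo%R.
  by apply/cvgryPge => A; near=> n; rewrite (@le_trans _ _ n%:R) ?ler_nat//;
    near: n; exact: nbhs_infty_ger.
have nN_cvg : (- n.+1%:R : R) @[n --> \oo] --> -oo%R by apply/cvgNrNy.
have IE n : (\int[mu]_(x in I n) (f x)%:E =
             (F n.+1%:R - F (- n.+1%:R))%:E)%E.
  have dF' (x : R) : derivable F x (1 : R) by have [] := dF x.
  have cF x : F y @[y --> x] --> F x.
    by apply/differentiable_continuous/derivable1_diffP.
  rewrite (continuous_FTC2 (F := F)) ?EFinB//.
  - by rewrite -subr_gt0 opprK -natrD ltr0n.
  - exact: continuous_subspaceT.
  - split=> //.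
    + exact/cvg_at_right_filter/cF.
    + exact/cvg_at_left_filter/cF.
  - by move=> x _; rewrite derive1E; have [_] := dF x.
have cvg0 : (\int[mu]_(x in I n) (f x)%:E)%E @[n --> \oo] --> (0 : \bar R)%E.
  under eq_fun do rewrite IE.
  apply: cvg_EFin; first exact: nearW.
  rewrite -[X in _ --> X](subr0 (0 : R)).
  apply: (@cvgB _ R^o).
    exact: (cvg_comp _ F n_cvg Fy).
  exact: (cvg_comp _ F nN_cvg FNy).
have cvgf : (\int[mu]_(x in I n) (f x)%:E)%E @[n --> \oo] -->
    (\int[mu]_x (f x)%:E)%E.
  under eq_fun do rewrite integral_mkcond.
  apply: (@dominated_cvg _ _ _ mu setT _ (fun n => (EFin \o f) \_ (I n)) _
    (abse \o (EFin \o f))) => //=.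
  - move=> n; apply/(measurable_restrictT _ _).1; first exact: measurable_itv.
    by apply: measurable_funTS; exact: measurable_int intf.
  - move=> x _; apply: cvg_near_cst; near=> n.
    rewrite patchE mem_set// /I/= in_itv/= -ler_norml.
    rewrite (@le_trans _ _ n%:R) ?ler_nat//.
    by near: n; exact: nbhs_infty_ger.
  - exact: integrable_abse.
  - by move=> n x _; rewrite patchE; case: ifP => //= _; rewrite normr0 lee_fin.
by rewrite /Rintegral (cvg_unique _ cvgf cvg0).
Unshelve. all: by end_near. Qed.

End integral_derivative.

(** * The characteristic function of a normal law *)

Section characteristic_function.
Context {R : realType}.
Notation mu := (@lebesgue_measure R).
Implicit Types b c m s t x : R.

(** Stein's identity [E ((Z - m) h Z) = s^2 E (h' Z)] for [h] a sine: the
    derivative of the product of [h] and the density integrates to zero, and the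
    logarithmic derivative of the density is [- (x - m) / s^2]. *)
Lemma stein_sin m s t c : s != 0 ->
  \int[mu]_x ((x - m) * sin (t * (x - m) + c) * normal_pdf m s x) =
  s ^+ 2 * t * \int[mu]_x (cos (t * (x - m) + c) * normal_pdf m s x).
Proof.
move=> s0.
have dlin x : is_derive x (1 : R) (fun y => t * (y - m) + c) t.
  by apply: is_derive_eq; rewrite /GRing.scale /=; ring.
have csin := @continuous_sin_affine R t m c.
have ccos := @continuous_cos_affine R t m c.
pose F x := sin (t * (x - m) + c) * normal_pdf m s x.
pose f x := t * (cos (t * (x - m) + c) * normal_pdf m s x) -
  (s ^+ 2)^-1 * ((x - m) * sin (t * (x - m) + c) * normal_pdf m s x).
have is1 := integrable_center_bounded_normal_pdf m s0 csin
  (fun x => normr_sin_le1 _).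
have ic1 := integrable_bounded_normal_pdf m s0 ccos (fun x => normr_cos_le1 _).
have dF x : is_derive x (1 : R) F (f x).
  have dpdf := derive_normal_pdf m x s0.
  have dsin : is_derive x (1 : R) (fun y => sin (t * (y - m) + c))
      (cos (t * (x - m) + c) * t) by exact: is_derive1_comp.
  by apply: is_derive_eq; rewrite /f /GRing.scale /=; field.
have cf : continuous f.
  have cpdf := @continuous_normal_pdf _ m s s0.
  move=> x; apply: (@cvgB _ R^o).
    by apply: cvgM; [exact: cvg_cst|apply: cvgM; [exact: ccos|exact: cpdf]].
  apply: cvgM; [exact: cvg_cst|apply: cvgM; [apply: cvgM|exact: cpdf]].
    by apply: (@cvgB _ R^o); [exact: cvg_id|exact: cvg_cst].
  exact: csin.
have F0 (G : set_system R) : Filter G ->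
    normal_pdf m s x @[x --> G] --> (0 : R) -> F x @[x --> G] --> (0 : R).
  move=> FG G0; apply: norm_cvg0.
  apply: (@squeeze_cvgr _ _ _ _ (cst 0) (normal_pdf m s)) => //;
    last exact: cvg_cst.
  apply: nearW => x; rewrite normr_ge0/= /F normrM.
  rewrite (ger0_norm (normal_pdf_ge0 _ _ _)) ler_piMl ?normal_pdf_ge0//.
  exact: normr_sin_le1.
have intf : mu.-integrable setT (EFin \o f).
  rewrite /comp /f.
  under eq_fun do rewrite EFinB !(EFinM t) (EFinM (s ^+ 2)^-1).
  by apply: integrableB => //; exact: integrableZl.
have := integral_derive_eq0 dF cf intf (F0 _ _ (cvg_normal_pdfy m s0))
  (F0 _ _ (cvg_normal_pdfNy m s0)).
rewrite /f RintegralB//; last 2 first.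
- by rewrite /comp; under eq_fun do rewrite EFinM; exact: integrableZl.
- by rewrite /comp; under eq_fun do rewrite EFinM; exact: integrableZl.
rewrite !RintegralZl// => /(_ _ _)/subr0_eq e.
by rewrite -mulrA e mulVKf// expf_neq0.
Qed.

Lemma is_derive_Rintegral_cos_normal_pdf m s c t : s != 0 ->
  is_derive t (1 : R)
    (fun t => \int[mu]_x (cos (t * (x - m) + c) * normal_pdf m s x))
    (- (s ^+ 2 * t * \int[mu]_x (cos (t * (x - m) + c) * normal_pdf m s x))).
Proof.
move=> s0; pose f t x := cos (t * (x - m) + c) * normal_pdf m s x.
have dlin x (u : R) : is_derive u (1 : R) (fun u => u * (x - m) + c) (x - m).
  by apply: is_derive_eq; rewrite /GRing.scale /=; ring.
have df x (u : R) : is_derive u (1 : R) (f ^~ x)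
    (- ((x - m) * sin (u * (x - m) + c) * normal_pdf m s x)).
  have dcos : is_derive u (1 : R) (fun u => cos (u * (x - m) + c))
      (- sin (u * (x - m) + c) * (x - m)) by exact: is_derive1_comp.
  by apply: is_derive_eq; rewrite /GRing.scale /=; ring.
have d1f u x : partial1of2 f u x =
    - ((x - m) * sin (u * (x - m) + c) * normal_pdf m s x).
  by rewrite partial1of2E; have [_] := df x u.
have intf u : mu.-integrable setT (EFin \o f u).
  apply: integrable_bounded_normal_pdf => //.
    exact: continuous_cos_affine.
  by move=> x; exact: normr_cos_le1.
(* any interval around [t] would do: the dominating function [|x - m|] times
   the density does not depend on the parameter *)
have It : `]t - 1, t + 1[%classic t by rewrite /= in_itv/=; lra.
have hyps := (fun (u : R) (_ : `]t - 1, t + 1[%classic u) => intf u,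
  fun u x (_ : `]t - 1, t + 1[%classic u) (_ : setT x) =>
    let: DeriveDef d _ := df x u in d).
have G_ge0 x : 0 <= `|x - m| * normal_pdf m s x.
  by rewrite mulr_ge0// normal_pdf_ge0.
have G_ub (u x : R) : `]t - 1, t + 1[%classic u -> setT x ->
    `|partial1of2 f u x| <= `|x - m| * normal_pdf m s x.
  move=> _ _; rewrite d1f normrN normrM (ger0_norm (normal_pdf_ge0 _ _ _)).
  rewrite ler_wpM2r ?normal_pdf_ge0// normrM ler_piMr//.
  exact: normr_sin_le1.
have intG := integrable_center_normal_pdf m s0.
apply: DeriveDef.
  exact: (derivable_under_integral measurableT It hyps.1 hyps.2
    G_ge0 intG G_ub).
rewrite -derive1E.
rewrite (differentiation_under_integral measurableT It hyps.1 hyps.2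
  G_ge0 intG G_ub).
rewrite -stein_sin//; under eq_Rintegral do rewrite d1f -mulN1r.
rewrite RintegralZl ?mulN1r//.
apply: integrable_center_bounded_normal_pdf => //.
  exact: continuous_sin_affine.
by move=> x; exact: normr_sin_le1.
Qed.

(** By the previous lemma, the integral times [e^(s^2 t^2 / 2)] does not depend
    on [t]; at [t = 0] it is [cos c]. *)
Lemma Rintegral_cos_normal_pdf m s t c : s != 0 ->
  \int[mu]_x (cos (t * (x - m) + c) * normal_pdf m s x) =
  expR (- (s ^+ 2 * t ^+ 2 / 2)) * cos c.
Proof.
move=> s0; pose F t := \int[mu]_x (cos (t * (x - m) + c) * normal_pdf m s x).
pose H t := expR (s ^+ 2 * t ^+ 2 / 2) * F t.
have dH u : is_derive u (1 : R) H 0.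
  have dF : is_derive u (1 : R) F (- (s ^+ 2 * u * F u)).
    exact: is_derive_Rintegral_cos_normal_pdf.
  have dq : is_derive u (1 : R) (fun u => s ^+ 2 * u ^+ 2 / 2) (s ^+ 2 * u).
    by apply: is_derive_eq; rewrite /GRing.scale /=; field.
  have dE : is_derive u (1 : R) (fun u => expR (s ^+ 2 * u ^+ 2 / 2))
      (expR (s ^+ 2 * u ^+ 2 / 2) * (s ^+ 2 * u)) by exact: is_derive1_comp.
  by apply: is_derive_eq; rewrite /GRing.scale /=; ring.
have : H t = H 0 by exact: is_derive_0_is_cst.
have F0 : F 0 = cos c.
  rewrite /F; under eq_Rintegral do rewrite mul0r add0r.
  rewrite RintegralZl//; last exact: integrable_normal_pdf.
  by rewrite /Rintegral integral_normal_pdf mulr1.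
rewrite /H F0 expr0n mulr0 mul0r expR0 mul1r => <-.
by rewrite mulrA -expRD addNr expR0 mul1r.
Qed.

Lemma Rintegral_expR_cos_normal_pdf m s b t c : s != 0 ->
  \int[mu]_x (expR (b * x) * cos (t * x + c) * normal_pdf m s x) =
  expR (b * m + s ^+ 2 * b ^+ 2 / 2 - s ^+ 2 * t ^+ 2 / 2) *
  cos (t * (m + b * s ^+ 2) + c).
Proof.
move=> s0.
(* mean of the tilted density *)
set n := m + b * s ^+ 2.
transitivity (\int[mu]_x (expR (b * m + s ^+ 2 * b ^+ 2 / 2) *
    (cos (t * (x - n) + (t * n + c)) * normal_pdf n s x))).
  apply: eq_Rintegral => x _.
  rewrite mulrAC normal_pdf_tilt// -/n mulrAC -mulrA.
  by congr (_ * (cos _ * _)); ring.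
rewrite RintegralZl// ?Rintegral_cos_normal_pdf// ?mulrA -?expRD//.
apply: integrable_bounded_normal_pdf => //.
  exact: continuous_cos_affine.
by move=> x; exact: normr_cos_le1.
Qed.

End characteristic_function.

(** * The law of the dart *)

Section law.
Context {R : realType}.
Notation mu := (@lebesgue_measure R).

(** Absolute continuity provides an abstract density; by uniqueness of
    Radon-Nikodym derivatives it agrees almost everywhere with the explicit
    one. *)
Lemma ge0_integral_normal_prob (m s : R) (h : R -> \bar R) :
  measurable_fun setT h -> (forall x, 0 <= h x)%E ->
  (\int[normal_prob m s]_x h x = \int[mu]_x (h x * (normal_pdf m s x)%:E))%E.
Proof.
move=> mh h0; have numu := @normal_prob_dominates R m s.
rewrite -(Radon_Nikodym_SigmaFinite.change_of_variables numu h0)//.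
have mpdf : measurable_fun setT (fun x => (normal_pdf m s x)%:E).
  by apply/measurable_EFinP; exact: measurable_normal_pdf.
have intf := Radon_Nikodym_SigmaFinite.f_integrable numu.
apply: ae_eq_integral => //.
- by apply: emeasurable_funM => //; exact: measurable_int intf.
- exact: emeasurable_funM.
- apply: ae_eqe_mul2l; apply: integral_ae_eq => //= E _ mE.
  by rewrite -Radon_Nikodym_SigmaFinite.f_integral.
Qed.

Context {disp : measure_display} {T : measurableType disp}
  {P : probability T R}.
Context (p s : R) (X : {RV P >-> R})
  (p01 : 0 < p < 1) (s0 : 0 < s) (hX : bern_plus_normal p s X).

(** Split along the events [X1 = 0] and [X1 = 1]; on each of them [X] is a
    translate of [X2], which is independent of the event. *)
Lemma bern_plus_normal_law (B : set R) : measurable B ->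
  (P (X @^-1` B) = (1 - p)%:E * normal_prob 0 s B +
    p%:E * normal_prob 0 s ((fun x : R => (1 + x)%R) @^-1` B))%E.
Proof.
move=> mB; have [X1 [X2 [l1 l2 ind XE]]] := hX.
have mX (Y : {RV P >-> R}) (A : set R) : measurable A -> measurable (Y @^-1` A).
  by move=> mA; rewrite -[_ @^-1` _]setTI; exact: measurable_funP.
have mB1 : measurable ((fun x : R => 1 + x) @^-1` B).
  by rewrite -[_ @^-1` _]setTI; apply: measurable_funD.
pose A k := X1 @^-1` [set (k : R)].
have mA k : measurable (A k) by apply: mX.
have XA k : X @^-1` B `&` A k = A k `&` X2 @^-1` ((fun x => k + x) @^-1` B).
  apply/seteqP; split => w /=; rewrite /A /= XE.
    by move=> [BX1 X1k]; split; rewrite -?X1k.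
  by move=> [X1k BX]; rewrite X1k.
have add0 : (fun x : R => 0 + x) @^-1` B = B.
  by apply/seteqP; split => x /=; rewrite add0r.
have PXA k : measurable ((fun x => k + x) @^-1` B) -> P (X @^-1` B `&` A k) =
    (bern p [set k] * normal_prob 0 s ((fun x : R => (k + x)%R) @^-1` B))%E.
  by move=> mk; rewrite XA /A ind// -l1// -l2.
rewrite (measureDI _ (mX X B mB) (measurableU _ _ (mA 0) (mA 1))).
(* the Bernoulli variable almost surely takes one of the values 0 and 1 *)
have PD : P (X @^-1` B `\` (A 0 `|` A 1)) = 0%E.
  apply/eqP; rewrite -measure_le0.
  have -> : 0%E = distribution P X1 (~` [set (0 : R); 1]).
    rewrite l1; last by apply: measurableC; exact: measurableU.
    have n0 : ~ (~` [set (0 : R); 1]) 0 by apply; left.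
    have n1 : ~ (~` [set (0 : R); 1]) 1 by apply; right.
    by rewrite /bern !diracE (memNset n0) (memNset n1) !mule0 adde0.
  apply: le_measure; rewrite ?inE.
  - by apply: measurableD; [exact: mX|exact: measurableU].
  - by apply: mX; apply: measurableC; exact: measurableU.
  - by move=> w [_ /= n01] h; apply: n01; rewrite /A /=.
rewrite [X in (X + _)%E]PD add0e setIUr measureU; last 3 first.
- by apply: measurableI => //; exact: mX.
- by apply: measurableI => //; exact: mX.
- apply/seteqP; split => w //= [[_]]; rewrite /A/= => -> [_] /eqP.
  by rewrite eq_sym oner_eq0.
rewrite [X in (X + _)%E = _](PXA 0) ?add0// [X in (_ + X)%E = _](PXA 1)//.
congr (_ * _ + _ * _)%E; rewrite /bern !diracE.
  rewrite (memNset (_ : ~ [set 0] 1)) ?mem_set//=.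
    by rewrite mule0 add0e mule1.
  by apply/eqP; rewrite oner_eq0.
rewrite (memNset (_ : ~ [set 1] 0)) ?mem_set//=.
  by rewrite mule0 adde0 mule1.
by apply/eqP; rewrite eq_sym oner_eq0.
Qed.

Lemma ge0_integral_bern_plus_normal (h : R -> \bar R) :
  measurable_fun setT h -> (forall x, 0 <= h x)%E ->
  (\int[P]_w h (X w) =
    (1 - p)%:E * \int[mu]_x (h x * (normal_pdf 0 s x)%:E) +
    p%:E * \int[mu]_x (h (1 + x)%R * (normal_pdf 0 s x)%:E))%E.
Proof.
move=> mh h0; have /andP[/ltW p0 /ltW p1] := p01.
have q0 : 0 <= 1 - p by rewrite subr_ge0.
(* the two atoms of the Bernoulli part translate the normal law by 0 and 1; the
   translation by 0 also carries that law from [measurableTypeR R] to [R], which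
   have the same measurable sets but different displays *)
pose shift (k : R) : measurableTypeR R -> R := fun x => k + x.
have mshift k : measurable_fun setT (shift k).
  move=> _ B mB; rewrite setTI -[_ @^-1` _]setTI.
  have : measurable_fun setT (fun x : R => k + x) by apply: measurable_funD.
  exact.
pose S k : {mfun measurableTypeR R >-> R} :=
  HB.pack (shift k) (isMeasurableFun.Build _ _ _ _ _ (mshift k)).
pose nu : probability (measurableTypeR R) R := normal_prob (0 : R) s.
pose law : {measure set R -> \bar R} := measure_add
  (mscale (NngNum q0) (distribution nu (S 0)))
  (mscale (NngNum p0) (distribution nu (S 1))).
rewrite -[LHS](@ge0_integral_distribution _ _ _ _ _ P X h)//.
rewrite (eq_measure_integral law); last first.
  move=> B mB _; rewrite [RHS]measure_addE.
  apply: etrans (bern_plus_normal_law mB) _.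
  congr (_ * normal_prob 0 s _ + _)%E.
  by apply/seteqP; split => x /=; rewrite /shift add0r.
rewrite ge0_integral_measure_add// !ge0_integral_mscale//=.
rewrite !ge0_integral_distribution// !ge0_integral_normal_prob//=.
  by congr (_ * _ + _)%E; apply: eq_integral => x _; rewrite /shift add0r.
- exact: (measurableT_comp mh (mshift 1)).
- exact: (measurableT_comp mh (mshift 0)).
Qed.

End law.

(** * Exponential moments of the dart *)

Section moments.
Context {R : realType}.
Notation mu := (@lebesgue_measure R).
Context {disp : measure_display} {T : measurableType disp}
  {P : probability T R}.
Context (p s : R) (X : {RV P >-> R})
  (p01 : 0 < p < 1) (s0 : 0 < s) (hX : bern_plus_normal p s X).

Let pairing (f : R -> R) : R :=
  (1 - p) * \int[mu]_x (f x * normal_pdf 0 s x) +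
  p * \int[mu]_x (f (1 + x) * normal_pdf 0 s x).

Let density_integrable (f : R -> R) :=
  mu.-integrable setT (fun x => (f x * normal_pdf 0 s x)%:E) /\
  mu.-integrable setT (fun x => (f (1 + x) * normal_pdf 0 s x)%:E).

Let ge0_pairing (f : R -> R) : measurable_fun setT f -> (forall x, 0 <= f x) ->
  density_integrable f ->
  P.-integrable setT (fun w => (f (X w))%:E) /\
  (\int[P]_w (f (X w))%:E = (pairing f)%:E)%E.
Proof.
move=> mf f0 [i0 i1].
have mE : measurable_fun setT (EFin \o f) by exact/measurable_EFinP.
have fE0 x : (0 <= (f x)%:E)%E by rewrite lee_fin.
have e : (\int[P]_w (f (X w))%:E = (pairing f)%:E)%E.
  rewrite (ge0_integral_bern_plus_normal p01 hX mE fE0) /pairing.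
  rewrite [RHS]EFinD [in RHS](EFinM (1 - p)) [in RHS](EFinM p).
  rewrite /Rintegral !fineK; last 2 first.
  - exact: integrable_fin_num.
  - exact: integrable_fin_num.
  by [].
split=> //; apply/integrableP; split.
  by apply/measurable_EFinP; exact: measurableT_comp.
under eq_integral do rewrite gee0_abs ?lee_fin//.
by rewrite e ltry.
Qed.

(** The signed case follows from the nonnegative one by writing [f] as the
    difference of [f + |f|] and [|f|]. *)
Lemma integral_bern_plus_normal (f : R -> R) : measurable_fun setT f ->
  mu.-integrable setT (fun x => (f x * normal_pdf 0 s x)%:E) ->
  mu.-integrable setT (fun x => (f (1 + x) * normal_pdf 0 s x)%:E) ->
  P.-integrable setT (fun w => (f (X w))%:E) /\
  (\int[P]_w (f (X w))%:E =
   ((1 - p) * \int[mu]_x (f x * normal_pdf 0 s x) +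
    p * \int[mu]_x (f (1 + x) * normal_pdf 0 s x))%:E)%E.
Proof.
move=> mf i0 i1; rewrite -/(pairing f).
pose g x := `|f x|; pose h x := f x + g x.
have abs_pdf (k : R -> R) :
    mu.-integrable setT (fun x => (k x * normal_pdf 0 s x)%:E) ->
    mu.-integrable setT (fun x => (`|k x| * normal_pdf 0 s x)%:E).
  move=> /integrable_abse; apply: eq_integrable => // x _ /=.
  by rewrite normrM (ger0_norm (normal_pdf_ge0 _ _ _)).
have add_pdf (k l : R -> R) :
    mu.-integrable setT (fun x => (k x * normal_pdf 0 s x)%:E) ->
    mu.-integrable setT (fun x => (l x * normal_pdf 0 s x)%:E) ->
    mu.-integrable setT (fun x => ((k x + l x) * normal_pdf 0 s x)%:E).
  move=> ik il; under eq_fun do rewrite mulrDl EFinD.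
  exact: integrableD.
have g0 := abs_pdf _ i0; have g1 := abs_pdf _ i1.
have h0 := add_pdf _ _ i0 g0; have h1 := add_pdf _ _ i1 g1.
have mg : measurable_fun setT g by exact: measurableT_comp.
have mh : measurable_fun setT h by exact: measurable_funD.
have [Pg Eg] := ge0_pairing mg (fun x => normr_ge0 _) (conj g0 g1).
have hge0 x : 0 <= h x by rewrite /h /g -lerBlDl sub0r -normrN ler_norm.
have [Ph Eh] := ge0_pairing mh hge0 (conj h0 h1).
have fE w : (f (X w))%:E = ((h (X w))%:E - (g (X w))%:E)%E.
  by rewrite -EFinB addrK.
split; first by under eq_fun do rewrite fE; exact: integrableB.
under eq_integral do rewrite fE.
rewrite integralB//= Eg Eh -EFinB; congr EFin; rewrite /pairing /h.
have spl (k l : R -> R) :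
    mu.-integrable setT (fun x => (k x * normal_pdf 0 s x)%:E) ->
    mu.-integrable setT (fun x => (l x * normal_pdf 0 s x)%:E) ->
    \int[mu]_x ((k x + l x) * normal_pdf 0 s x) =
    \int[mu]_x (k x * normal_pdf 0 s x) + \int[mu]_x (l x * normal_pdf 0 s x).
  by move=> ik il; under eq_Rintegral do rewrite mulrDl; exact: RintegralD.
by rewrite !spl//; ring.
Qed.

Lemma integral_expR_cos_bern_plus_normal (b t c : R) :
  P.-integrable setT (fun w => (expR (b * X w) * cos (t * X w + c))%:E) /\
  (\int[P]_w (expR (b * X w) * cos (t * X w + c))%:E =
   (expR (s ^+ 2 * (b ^+ 2 - t ^+ 2) / 2) *
    ((1 - p) * cos (t * b * s ^+ 2 + c) +
     p * expR b * cos (t * b * s ^+ 2 + t + c)))%:E)%E.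
Proof.
have sn0 : s != 0 by rewrite gt_eqF.
pose f x := expR (b * x) * cos (t * x + c).
have f1 x : f (1 + x) = expR b * (expR (b * x) * cos (t * x + (t + c))).
  by rewrite /f mulrDr mulr1 expRD -mulrA; congr (_ * (_ * cos _)); ring.
have mf : measurable_fun setT f.
  by apply: continuous_measurable_fun; exact: continuous_expR_cos.
have i0 := integrable_expR_cos_normal_pdf 0 b t c sn0.
have i1' := integrable_expR_cos_normal_pdf 0 b t (t + c) sn0.
have i1 : mu.-integrable setT (fun x => (f (1 + x) * normal_pdf 0 s x)%:E).
  under eq_fun do rewrite f1 -[X in X%:E]mulrA EFinM.
  exact: integrableZl.
have [intf ->] := integral_bern_plus_normal mf i0 i1; split=> //.
congr EFin; rewrite Rintegral_expR_cos_normal_pdf//.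
under eq_Rintegral do rewrite f1 -mulrA.
rewrite RintegralZl// Rintegral_expR_cos_normal_pdf//.
have -> : b * 0 + s ^+ 2 * b ^+ 2 / 2 - s ^+ 2 * t ^+ 2 / 2 =
  s ^+ 2 * (b ^+ 2 - t ^+ 2) / 2 by field.
have -> : t * (0 + b * s ^+ 2) + c = t * b * s ^+ 2 + c by ring.
have -> : t * (0 + b * s ^+ 2) + (t + c) = t * b * s ^+ 2 + t + c by ring.
by ring.
Qed.

End moments.

(** * Amplitude of a sum of two oscillations *)

Section real_analysis.
Context {R : realType}.
Implicit Types (a d p x y : R).

Lemma is_derive_nonincreasing_le0 (g dg : R -> R) :
  (forall x, 0 < x -> is_derive x (1 : R) g (dg x)) ->
  (forall x y, 0 < x -> x <= y -> g y <= g x) ->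
  forall x, 0 < x -> dg x <= 0.
Proof.
move=> dgE gdecr x x0; apply/ler_addgt0Pl => e e0; rewrite addr0.
(* subtracting a linear term makes the monotonicity strict *)
pose h : R -> R := g - e \*: id.
have dh y : 0 < y -> is_derive y (1 : R) h (dg y - e).
  move=> y0; have := dgE y y0 => dgy.
  by apply: is_derive_eq; rewrite /GRing.scale /= mulr1.
have := @decr_derive1_le0_itvy _ h false 0 x; rewrite derive1E.
have [_ ->] := dh x x0; rewrite subr_le0; apply.
- by move=> y; rewrite inE/= in_itv/= andbT => /dh[].
- move=> y z; rewrite !in_itv/= !andbT => y0 z0 zy.
  change (g y - e * y < g z - e * z); have := gdecr _ _ z0 (ltW zy).
  have : e * z < e * y by rewrite ltr_pM2l.
  by lra.
- by rewrite in_itv/= x0.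
Qed.

Lemma cos_sin_surj x y : x ^+ 2 + y ^+ 2 = 1 ->
  exists a, cos a = x /\ sin a = y.
Proof.
move=> xy1; have x1 : -1 <= x <= 1.
  rewrite -ler_norml -(@ler_pXn2r _ 2) ?nnegrE// expr1n real_normK ?num_real//.
  by have := sqr_ge0 y; lra.
have sE : Num.sqrt (1 - x ^+ 2) = `|y|.
  by rewrite -xy1 addrAC subrr add0r sqrtr_sqr.
have [y0|y0] := leP 0 y.
  by exists (acos x); rewrite acosK ?in_itv//= sin_acos// sE ger0_norm.
exists (- acos x); rewrite cosN sinN acosK ?in_itv//= sin_acos// sE ltr0_norm//.
by rewrite opprK.
Qed.

(** The squared modulus of the characteristic function [1 - p + p e^(id)] of the
    Bernoulli law. *)
Definition spread p d := p ^+ 2 + (1 - p) ^+ 2 + 2 * (1 - p) * p * cos d.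

Lemma spreadE p d :
  spread p d = ((1 - p) + p * cos d) ^+ 2 + (p * sin d) ^+ 2.
Proof. by rewrite /spread !exprMn sin2cos2; ring. Qed.

Lemma spread_ge0 p d : 0 <= spread p d.
Proof. by rewrite spreadE addr_ge0 ?sqr_ge0. Qed.

Lemma phasorE p a d : (1 - p) * cos a + p * cos (a + d) =
  ((1 - p) + p * cos d) * cos a - p * sin d * sin a.
Proof. by rewrite cosD; ring. Qed.

(** [spread p d] is the squared norm of a plane vector [(A, B)] whose inner
    product with the unit vector [(cos a, - sin a)] is the left-hand side, so
    that Cauchy-Schwarz applies; the next lemma picks the unit vector along
    [(A, B)]. *)
Lemma phasor_le p a d :
  (1 - p) * cos a + p * cos (a + d) <= Num.sqrt (spread p d).
Proof.
rewrite (le_trans (ler_norm _))// -sqrtr_sqr ler_wsqrtr// phasorE spreadE.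
set A := 1 - p + p * cos d; set B := p * sin d.
have e : A ^+ 2 + B ^+ 2 =
    (A * cos a - B * sin a) ^+ 2 + (A * sin a + B * cos a) ^+ 2.
  rewrite -[LHS]mulr1 -(cos2Dsin2 a); ring.
by rewrite e lerDl sqr_ge0.
Qed.

Lemma phasor_eq p d : exists a,
  (1 - p) * cos a + p * cos (a + d) = Num.sqrt (spread p d).
Proof.
set r := Num.sqrt _.
have r2 : r ^+ 2 = spread p d by rewrite sqr_sqrtr// spread_ge0.
pose A := (1 - p) + p * cos d; pose B := p * sin d.
have AB : A ^+ 2 + B ^+ 2 = r ^+ 2 by rewrite r2 spreadE.
have [r0|r0] := eqVneq r 0.
  move: AB; rewrite r0 expr0n/= => /eqP; rewrite paddr_eq0 ?sqr_ge0// !sqrf_eq0.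
  move=> /andP[/eqP A0 /eqP B0]; exists 0.
  by rewrite phasorE -/A -/B A0 B0; ring.
have [|a [ca sa]] := @cos_sin_surj (A / r) (- B / r).
  by rewrite !expr_div_n sqrrN -mulrDl AB divff// expf_neq0.
exists a; rewrite phasorE -/A -/B ca sa.
have -> : A * (A / r) - B * (- B / r) = (A ^+ 2 + B ^+ 2) / r by field.
by rewrite AB expr2 mulfK.
Qed.

End real_analysis.

(** * The cosine payoff *)

Section cosine.
Context {R : realType} {disp : measure_display} {T : measurableType disp}
  {P : probability T R}.
Context (p s : R) (X : {RV P >-> R})
  (p01 : 0 < p < 1) (s0 : 0 < s) (hX : bern_plus_normal p s X).

Lemma expectation_cos (a d : R) :
  ('E_P[fun w => cos (a + d * X w)] =
   (expR (- (s ^+ 2 * d ^+ 2 / 2)) * ((1 - p) * cos a + p * cos (a + d)))%:E)%E.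
Proof.
have [_ e] := integral_expR_cos_bern_plus_normal p01 s0 hX 0 d a.
rewrite unlock.
transitivity (\int[P]_w (expR (0 * X w) * cos (d * X w + a))%:E)%E.
  by apply: eq_integral => w _; rewrite mul0r expR0 mul1r addrC.
rewrite e expR0 mulr1; congr (expR _ * (_ * cos _ + _ * cos _))%:E.
- by field.
- by ring.
- by ring.
Qed.

Lemma dart_gain_cos (d : R) : dart_gain X cos d =
  (expR (- (s ^+ 2 * d ^+ 2 / 2)) * Num.sqrt (spread p d))%:E.
Proof.
apply/eqP; rewrite eq_le; apply/andP; split.
  apply: ge_ereal_sup => _ [a _ <-].
  by rewrite expectation_cos lee_fin ler_wpM2l ?expR_ge0// phasor_le.
have [a aE] := phasor_eq p d.
by apply: ereal_sup_ubound; exists a => //; rewrite expectation_cos aE.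
Qed.

Let gain2 (d : R) := expR (- (s ^+ 2 * d ^+ 2)) * spread p d.

Let dart_gain_le (d1 d2 : R) :
  (dart_gain X cos d2 <= dart_gain X cos d1)%E = (gain2 d2 <= gain2 d1).
Proof.
rewrite !dart_gain_cos lee_fin.
rewrite -(@ler_pXn2r _ 2) ?nnegrE ?mulr_ge0 ?expR_ge0 ?sqrtr_ge0//.
rewrite !exprMn !sqr_sqrtr ?spread_ge0// -!expRM_natl.
by rewrite /gain2; congr (expR _ * _ <= expR _ * _); field.
Qed.

Let is_derive_gain2 (d : R) : is_derive d (1 : R) gain2
  (- 2 * expR (- (s ^+ 2 * d ^+ 2)) *
    (s ^+ 2 * d * spread p d + (1 - p) * p * sin d)).
Proof.
have dq : is_derive d (1 : R) (fun u => - (s ^+ 2 * u ^+ 2))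
    (- (s ^+ 2 * (2 * d))).
  by apply: is_derive_eq; rewrite /GRing.scale /=; ring.
have dE : is_derive d (1 : R) (fun u => expR (- (s ^+ 2 * u ^+ 2)))
    (expR (- (s ^+ 2 * d ^+ 2)) * - (s ^+ 2 * (2 * d))).
  exact: is_derive1_comp.
have dS : is_derive d (1 : R) (spread p) (- (2 * (1 - p) * p * sin d)).
  by apply: is_derive_eq; rewrite /GRing.scale /=; ring.
by apply: is_derive_eq; rewrite /GRing.scale /=; ring.
Qed.

Lemma reasonable_cosP : reasonable_wrt X cos <->
  forall d : R, 0 <= d ->
    0 <= s ^+ 2 * d * spread p d + (1 - p) * p * sin d.
Proof.
have neg (u v : R) : (- 2 * expR u * v <= 0) = (0 <= v).
  by rewrite nmulr_rle0// nmulr_rlt0 ?expR_gt0//; lra.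
split=> [reas d|crit d1 d2 d10 d12].
  rewrite le_eqVlt => /predU1P[<-|d0]; first by rewrite sin0; lra.
  rewrite -(neg (- (s ^+ 2 * d ^+ 2))).
  apply: (is_derive_nonincreasing_le0 (fun x _ => is_derive_gain2 x)) d0.
  by move=> x y x0 xy; rewrite -dart_gain_le; exact: reas.
rewrite dart_gain_le.
have der x : derivable gain2 x 1 by have [] := is_derive_gain2 x.
apply: (@ler0_derive1_nincry _ gain2 0) => //.
- move=> x; rewrite in_itv/= andbT => x0; rewrite derive1E.
  by have [_ ->] := is_derive_gain2 x; rewrite neg crit// ltW.
- by apply: derivable_within_continuous => x _.
- exact: ltW.
Qed.

(** For a fair coin the gain vanishes at [pi] and is positive at [2 pi]. *)
Lemma half_not_reasonable_cos : p = 1 / 2 -> ~ reasonable_wrt X cos.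
Proof.
move=> p12 /(_ pi (pi *+ 2) (pi_gt0 R)).
rewrite !dart_gain_cos lee_fin {2}/spread cospi p12.
have -> : (1 / 2) ^+ 2 + (1 - 1 / 2) ^+ 2 +
    2 * (1 - 1 / 2) * (1 / 2) * -1 = 0 :> R.
  by field.
rewrite sqrtr0 mulr0 => /(_ _)/wrap[].
  by have := pi_gt0 R; rewrite mulr2n; lra.
apply/negP; rewrite -ltNge mulr_gt0 ?expR_gt0// sqrtr_gt0 /spread cos2pi.
by lra.
Qed.

End cosine.

(** * The threshold variance *)

Section threshold.
Context {R : realType}.
Implicit Types (d p v : R).

Lemma spread_lb p d : 0 < p < 1 -> (1 - 2 * p) ^+ 2 <= spread p d.
Proof.
move=> /andP[p0 p1]; rewrite -subr_ge0 /spread.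
have -> : p ^+ 2 + (1 - p) ^+ 2 + 2 * (1 - p) * p * cos d - (1 - 2 * p) ^+ 2 =
  2 * ((1 - p) * p) * (1 + cos d) by ring.
have q0 : 0 < (1 - p) * p by rewrite mulr_gt0// subr_gt0.
apply: mulr_ge0; first by rewrite mulr_ge0// ltW.
by have := cos_geN1 d; lra.
Qed.

(** The least variance for which the criterion holds at [d]. *)
Definition critical_variance p d := - ((1 - p) * p * sin d) / (d * spread p d).

Definition critical_variances p := critical_variance p @` [set d | 0 < d].

Context (p : R) (p01 : 0 < p < 1) (p12 : p != 1 / 2).

Let gap_gt0 : 0 < (1 - 2 * p) ^+ 2.
Proof. by rewrite exprn_even_gt0//=; apply: contra_neq p12; lra. Qed.

Let q_gt0 : 0 < (1 - p) * p.
Proof. by move: p01 => /andP[? ?]; rewrite mulr_gt0// subr_gt0. Qed.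

Let spread_gt0 d : 0 < spread p d.
Proof. by rewrite (lt_le_trans gap_gt0)// spread_lb. Qed.

Lemma critical_varianceP d v : 0 < d ->
  (critical_variance p d <= v) =
  (0 <= v * d * spread p d + (1 - p) * p * sin d).
Proof.
move=> d0; rewrite ler_pdivrMr ?mulr_gt0//.
by rewrite -[LHS]subr_ge0 opprK mulrA.
Qed.

(** For [d <= pi] the sine is nonnegative and the critical variance is
    nonpositive; for [d > pi] bound the sine below by -1, [d] by [pi] and
    [spread p d] by [(1 - 2p)^2]. *)
Lemma critical_variances_ub :
  ubound (critical_variances p) ((1 - p) * p / (pi * `|1 - 2 * p| ^+ 2)).
Proof.
move=> _ [d d0 <-]; rewrite critical_varianceP//.
have p0 := pi_gt0 R; rewrite real_normK ?num_real//.
set M := _ / _; have M0 : 0 < M by rewrite divr_gt0// mulr_gt0.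
have [dpi|dpi] := leP d pi.
  have sd : 0 <= sin d by rewrite sin_ge0_pi// dpi ltW.
  apply: addr_ge0; last exact: mulr_ge0 (ltW q_gt0) sd.
  exact: ltW (mulr_gt0 (mulr_gt0 M0 d0) (spread_gt0 d)).
have -> : (1 - p) * p * sin d = - (M * pi * (1 - 2 * p) ^+ 2) * (- sin d).
  rewrite /M -[_ / _ * pi * _]mulrA divfK ?mulrNN//.
  by rewrite mulf_neq0// gt_eqF.
rewrite mulNr subr_ge0.
apply: (@le_trans _ _ (M * pi * (1 - 2 * p) ^+ 2)).
  rewrite ler_piMr; [by []| |by rewrite lerNl sin_geN1].
  exact: ltW (mulr_gt0 (mulr_gt0 M0 p0) gap_gt0).
apply: ler_pM; [|exact: sqr_ge0| |exact: spread_lb].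
  exact: ltW (mulr_gt0 M0 p0).
by rewrite ler_pM2l// ltW.
Qed.

Lemma has_sup_critical_variances : has_sup (critical_variances p).
Proof.
split; first by exists (critical_variance p 1); exists 1 => //=.
exists ((1 - p) * p / (pi * `|1 - 2 * p| ^+ 2)).
exact: critical_variances_ub.
Qed.

Lemma sup_critical_variances_gt0 : 0 < sup (critical_variances p).
Proof.
have d0 : 0 < pi + pi / 2 :> R by have := pi_gt0 R; lra.
apply: (@lt_le_trans _ _ (critical_variance p (pi + pi / 2))).
  rewrite divr_gt0 ?mulr_gt0//.
  by rewrite sinDpihalf cospi mulrN1 opprK.
by apply: sup_ubound; [case: has_sup_critical_variances|exists (pi + pi / 2)].
Qed.

Lemma sup_critical_variancesP v :
  sup (critical_variances p) <= v <->
  forall d, 0 <= d -> 0 <= v * d * spread p d + (1 - p) * p * sin d.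
Proof.
split=> [supv d|crit].
  rewrite le_eqVlt => /predU1P[<-|d0].
    by rewrite sin0 !(mulr0, mul0r) addr0.
  rewrite -critical_varianceP// (le_trans _ supv)//.
  by apply: sup_ubound; [case: has_sup_critical_variances|exists d].
apply: ge_sup; first by case: has_sup_critical_variances.
by move=> _ [d d0 <-]; rewrite critical_varianceP// crit// ltW.
Qed.

End threshold.

(** * Exponentially tilted payoffs *)

Section tilting.
Context {R : realType} {disp : measure_display} {T : measurableType disp}
  {P : probability T R}.
Context (p s : R) (X : {RV P >-> R})
  (p01 : 0 < p < 1) (s0 : 0 < s) (hX : bern_plus_normal p s X).

Definition tilted_cos (b c e : R) (y : R) : R :=
  expR (b * y) * cos (y + c) - e * expR (2 * b * y).

(** With [u = e^(by)], the function is at most [u - e u^2 <= 1 / (4e)]. *)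
Lemma payoff_tilted_cos (b c e : R) : 0 < e -> payoff (tilted_cos b c e).
Proof.
move=> e0; split.
  have -> : tilted_cos b c e = (fun y => expR (b * y) * cos (1 * y + c) -
      e * (expR (2 * b * y) * cos (0 * y + 0))).
    by apply/funext => y; rewrite /tilted_cos mul1r mul0r addr0 cos0 mulr1.
  apply: continuous_measurable_fun => x; apply: (@cvgB _ R^o).
    exact: continuous_expR_cos.
  by apply: cvgM; [exact: cvg_cst|exact: continuous_expR_cos].
exists ((4 * e)^-1) => _ [y _ <-]; rewrite /tilted_cos.
set u := expR (b * y); have u0 : 0 < u by exact: expR_gt0.
have -> : expR (2 * b * y) = u ^+ 2 by rewrite -expRM_natl mulrA.
apply: (@le_trans _ _ (u - e * u ^+ 2)).
  by rewrite lerB// ler_piMr ?cos_le1// ltW.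
rewrite -subr_ge0.
have -> : (4 * e)^-1 - (u - e * u ^+ 2) = e * (u - (2 * e)^-1) ^+ 2.
  by field; rewrite gt_eqF.
by rewrite mulr_ge0 ?sqr_ge0// ltW.
Qed.

Lemma expectation_tilted_cos (b c e a d : R) :
  ('E_P[fun w => tilted_cos b c e (a + d * X w)] =
   (expR (b * a) * (expR (s ^+ 2 * ((b * d) ^+ 2 - d ^+ 2) / 2) *
     ((1 - p) * cos (d * (b * d) * s ^+ 2 + (a + c)) +
      p * expR (b * d) * cos (d * (b * d) * s ^+ 2 + d + (a + c)))) -
    e * expR (2 * b * a) * (expR (s ^+ 2 * (2 * b * d) ^+ 2 / 2) *
     ((1 - p) + p * expR (2 * b * d))))%:E)%E.
Proof.
have [i1 e1] := integral_expR_cos_bern_plus_normal p01 s0 hX (b * d) d (a + c).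
have [i2 e2] := integral_expR_cos_bern_plus_normal p01 s0 hX (2 * b * d) 0 0.
rewrite unlock.
transitivity (\int[P]_w ((expR (b * a))%:E *
     (expR (b * d * X w) * cos (d * X w + (a + c)))%:E -
    (e * expR (2 * b * a))%:E *
     (expR (2 * b * d * X w) * cos (0 * X w + 0))%:E))%E.
  apply: eq_integral => w _; rewrite -!EFinM -EFinB /tilted_cos; congr EFin.
  rewrite mul0r addr0 cos0 mulr1.
  have -> : b * (a + d * X w) = b * a + b * d * X w by ring.
  have -> : 2 * b * (a + d * X w) = 2 * b * a + 2 * b * d * X w by ring.
  have -> : a + d * X w + c = d * X w + (a + c) by ring.
  by rewrite !expRD; ring.
rewrite integralB//; last 2 first.
- exact: integrableZl.
- exact: integrableZl.
rewrite !integralZl// e1 e2 -!EFinM -EFinB; congr EFin; congr (_ - _).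
by rewrite expr0n/= subr0 !mul0r !add0r cos0 !mulr1.
Qed.

(** The payoff is [tilted_cos b c e] with [p e^(b pi) = 1 - p].  At scale [pi]
    the two atoms of the Bernoulli part then have equal weights after tilting
    and opposite cosines, so only the negative correction term survives. *)
Lemma bern_plus_normal_not_reasonable : ~ reasonable X.
Proof.
move: (p01) => /andP[p0 p1] reas.
have q0 : 0 < 1 - p by rewrite subr_gt0.
have pi0 := pi_gt0 R.
pose b := ln ((1 - p) / p) / pi.
have bE : p * expR (b * pi) = 1 - p.
  rewrite /b divfK ?gt_eqF// lnK ?posrE ?divr_gt0//.
  by rewrite mulrC divfK ?gt_eqF.
(* the phase cancels the shift that tilting causes in the Gaussian part *)
pose d := pi *+ 2 : R; pose c := - (d * (b * d) * s ^+ 2).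
pose C := expR (s ^+ 2 * ((b * d) ^+ 2 - d ^+ 2) / 2) *
  ((1 - p) + p * expR (b * d)).
pose M := expR (s ^+ 2 * (2 * b * d) ^+ 2 / 2) *
  ((1 - p) + p * expR (2 * b * d)).
have C0 : 0 < C by rewrite mulr_gt0 ?expR_gt0// addr_gt0// mulr_gt0 ?expR_gt0.
have M0 : 0 < M by rewrite mulr_gt0 ?expR_gt0// addr_gt0// mulr_gt0 ?expR_gt0.
(* the correction term costs half of [C], the value at scale [d] without it *)
pose e := C / (2 * M); have e0 : 0 < e by rewrite divr_gt0// mulr_gt0.
have pid : pi <= d by rewrite /d mulr2n; lra.
have := reas _ (payoff_tilted_cos b c e0) pi d pi0 pid.
apply/negP; rewrite -ltNge.
apply: (@le_lt_trans _ _ 0%E).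
  apply: ge_ereal_sup => _ [a _ <-]; rewrite expectation_tilted_cos lee_fin.
  rewrite bE [_ + pi + (a + c)]addrAC cosDpi mulrN subrr !mulr0 sub0r oppr_le0.
  apply: mulr_ge0; first exact: mulr_ge0 (ltW e0) (expR_ge0 _).
  apply: mulr_ge0; first exact: expR_ge0.
  exact: addr_ge0 (ltW q0) (mulr_ge0 (ltW p0) (expR_ge0 _)).
apply: (@lt_le_trans _ _ (C / 2)%:E); first by rewrite lte_fin divr_gt0.
apply: ereal_sup_ubound; exists 0 => //.
rewrite expectation_tilted_cos !mulr0 expR0 !mul1r !mulr1; congr EFin.
have -> : d * (b * d) * s ^+ 2 + (0 + c) = 0 by rewrite /c; ring.
have -> : d * (b * d) * s ^+ 2 + d + (0 + c) = 0 + d by rewrite /c; ring.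
rewrite cosD2pi cos0 !mulr1 -/C -/M /e.
by field; rewrite gt_eqF.
Qed.

End tilting.

(** * Reasonableness of a Bernoulli plus normal dart *)

Theorem theorem1p13 (R : realType) :
  [/\ forall p sigma : R, 0 < p < 1 -> 0 < sigma ->
        forall (disp : measure_display) (T : measurableType disp)
               (P : probability T R) (X : {RV P >-> R}),
          bern_plus_normal p sigma X ->
          (reasonable_wrt X cos <->
           forall d : R, 0 <= d ->
             0 <= sigma ^+ 2 * d *
                    (p ^+ 2 + (1 - p) ^+ 2 + 2 * (1 - p) * p * cos d)
                  + (1 - p) * p * sin d),
      forall sigma : R, 0 < sigma ->
        forall (disp : measure_display) (T : measurableType disp)
               (P : probability T R) (X : {RV P >-> R}),
          bern_plus_normal (1 / 2) sigma X -> ~ reasonable_wrt X cos,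
      forall p : R, 0 < p < 1 -> p <> 1 / 2 ->
        exists sigma_p : R,
          [/\ 0 < sigma_p,
              forall sigma : R, sigma_p <= sigma ->
                forall (disp : measure_display) (T : measurableType disp)
                       (P : probability T R) (X : {RV P >-> R}),
                  bern_plus_normal p sigma X -> reasonable_wrt X cos,
              forall sigma : R, 0 < sigma -> sigma < sigma_p ->
                forall (disp : measure_display) (T : measurableType disp)
                       (P : probability T R) (X : {RV P >-> R}),
                  bern_plus_normal p sigma X -> ~ reasonable_wrt X cos &
              sigma_p ^+ 2 <= (1 - p) * p / (pi * `|1 - 2 * p| ^+ 2)] &
      forall p sigma : R, 0 < p < 1 -> 0 < sigma ->
        forall (disp : measure_display) (T : measurableType disp)
               (P : probability T R) (X : {RV P >-> R}),
          bern_plus_normal p sigma X -> ~ reasonable X].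
Proof.
split.
- by move=> p s p01 s0 disp T P X hX; exact: reasonable_cosP.
- move=> s s0 disp T P X hX; apply: (half_not_reasonable_cos _ s0 hX) => //.
  by apply/andP; split; lra.
- move=> p p01 /eqP p12; pose v := sup (critical_variances p).
  have v0 : 0 < v by exact: sup_critical_variances_gt0.
  have v2 : Num.sqrt v ^+ 2 = v by rewrite sqr_sqrtr// ltW.
  have sv0 : 0 < Num.sqrt v by rewrite sqrtr_gt0.
  exists (Num.sqrt v); split => //.
  + move=> s vs disp T P X hX; have s0 : 0 < s by exact: lt_le_trans vs.
    apply/(reasonable_cosP p01 s0 hX)/(sup_critical_variancesP p01 p12).
    by rewrite -/v -v2 ler_pXn2r ?nnegrE// ltW.
  + move=> s s0 sv disp T P X hX.
    move=> /(reasonable_cosP p01 s0 hX)/(sup_critical_variancesP p01 p12).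
    by apply/negP; rewrite -ltNge -/v -v2 ltr_pXn2r ?nnegrE ?ltW.
  + rewrite v2; apply: ge_sup.
      by case: (has_sup_critical_variances p01 p12).
    exact: critical_variances_ub.
- move=> p s p01 s0 disp T P X hX.
  exact: (bern_plus_normal_not_reasonable p01 s0 hX).
Qed.
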